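(* Let $f\in\mathbb{Z}[u^{\pm1}]$ be an irreducible nonhyperbolic polynomial which is not cyclotomic, and let $\alpha=\alpha_{R_1/(f)}$ be the associated automorphism of the compact connected abelian group $X=X_{R_1/(f)}$. For every $\alpha$-invariant probability measure $\mu$ on $X$ there exists a $\tilde\sigma$-invariant probability measure $\tilde\nu$ on $\tilde Y$ such that $\mu$ is centrally equivalent to the push-forward $\tilde\xi_*\tilde\nu$; moreover $\tilde\nu$ may be taken to be compactly supported.
   Context: Let $R_1=\mathbb{Z}[u^{\pm1}]$ and let $f=f_0+\dots+f_mu^m\in R_1$ be irreducible with $m>0$, $f_m>0$, $f_0\ne 0$. Let $\Omega_f\subset\mathbb{C}$ be its set of roots, and $\Omega_f^-$, $\Omega_f^{(0)}$, $\Omega_f^+$ the sets of roots of absolute value $<1$, $=1$, $>1$, respectively. The polynomial $f$ is nonhyperbolic if $\Omega_f^{(0)}\neq\varnothing$ and cyclotomic if $\Omega_f^{(0)}$ contains a root of unity. $\mathbb{T}=\mathbb{R}/\mathbb{Z}$, $X=X_{R_1/(f)}=\{x\in\mathbb{T}^{\mathbb{Z}}:\sum_{j=0}^m f_jx_{k+j}=0 \text{ for every } k\in\mathbb{Z}\}$, and $\alpha=\alpha_{R_1/(f)}$ is the restriction to $X$ of the shift $\tau(x)_n=x_{n+1}$. $\ell^\infty(\mathbb{Z},\mathbb{R})$ is the space of bounded real sequences, with the topology of coordinatewise convergence; $\ell^\infty(\mathbb{Z},\mathbb{Z})$ is the subgroup of integer-valued sequences. The shift is $(\bar\sigma w)_n=w_{n+1}$,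 and $f(\bar\sigma)=\sum_{j=0}^m f_j\bar\sigma^j$. Put $W_f^{(0)}=\{w\in\ell^\infty(\mathbb{Z},\mathbb{R}): f(\bar\sigma)w=0\}$, a finite-dimensional real vector space (with its usual topology). Let $\rho$ be coordinatewise reduction mod $1$ of real sequences (defined on all real sequences), and $X^{(0)}=\rho(W_f^{(0)})\subset X$ (the central subgroup; $\rho$ is injective on $W_f^{(0)}$). Write $\frac1{f(u)}=\frac1{f_m}\sum_{\omega\in\Omega_f}\frac{b_\omega}{u-\omega}$ with $b_\omega\in\mathbb{C}$ and define $w^{\Delta_+},w^{\Delta_-}\in\ell^\infty(\mathbb{Z},\mathbb{R})$ by $w^{\Delta_+}_n=\frac1{f_m}\sum_{\omega\in\Omega_f^-}b_\omega\omega^{n-1}$ if $n\ge1$, $w^{\Delta_+}_n=-\frac1{f_m}\sum_{\omega\in\Omega_f^{(0)}\cup\Omega_f^+}b_\omega\omega^{n-1}$ if $n\le0$; $w^{\Delta_-}_n=\frac1{f_m}\sum_{\omega\in\Omega_f^-\cup\Omega_f^{(0)}}b_\omega\omega^{n-1}$ if $n\ge1$, $w^{\Delta_-}_n=-\frac1{f_m}\sum_{\omega\in\Omega_f^+}b_\omega\omega^{n-1}$ if $n\le0$. For $v\in\ell^\infty(\mathbb{Z},\mathbb{Z})$ put $\bar\xi^*(v)=\sum_{n\ge0}v_n\bar\sigma^{-n}w^{\Delta_-}+\sum_{n<0}v_n\bar\sigma^{-n}w^{\Delta_+}$ (coordinatewise convergent; a real sequence of at most linear growth, to which $\bar\sigma$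 is extended by the same formula). For $n\in\mathbb{Z}$ put $\mathsf{d}(n,v)=\bar\sigma^n\bar\xi^*(v)-\bar\xi^*(\bar\sigma^nv)\in W_f^{(0)}$. $\tilde Y=\ell^\infty(\mathbb{Z},\mathbb{Z})\times W_f^{(0)}$ (identified with $\ell^\infty(\mathbb{Z},\mathbb{Z})\times X^{(0)}$ via the bijection $\rho|_{W_f^{(0)}}$), with the product topology; $\tilde\sigma(v,w)=(\bar\sigma v,\bar\sigma w+\mathsf{d}(1,v))$ is a homeomorphism of $\tilde Y$; and $\tilde\xi:\tilde Y\to X$ is the map $\tilde\xi(v,w)=\rho(\bar\xi^*(v)+w)$, which satisfies $\tilde\xi\circ\tilde\sigma=\alpha\circ\tilde\xi$. Two $\alpha$-invariant probability measures $\mu_1,\mu_2$ on $X$ are centrally equivalent if there is an $(\alpha\times\alpha)$-invariant measure $\varrho$ on $X\times X$ projecting to $\mu_1$ and $\mu_2$ in the two coordinates such that $x-y\in X^{(0)}$ for $\varrho$-a.e. $(x,y)$. *)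

(* Defs.v *)
From HB Require Import structures.
From mathcomp Require Import all_boot all_order all_algebra.
From mathcomp Require Import generic_quotient ring_quotient fraction complex.
From mathcomp Require Import all_classical all_reals all_analysis.
Import numFieldNormedType.Exports.

Set Implicit Arguments.
Unset Strict Implicit.
Unset Printing Implicit Defensive.

Import Order.TTheory GRing.Theory Num.Theory.

Local Open Scope classical_set_scope.
Local Open Scope ring_scope.

(* Z[u^{+-1}] is realised inside Frac(Z[u]) as the elements g / u^k. *)
Definition is_laurent (x : {fraction {poly int}}) : Prop :=
  exists (g : {poly int}) (k : nat), x = tofrac g / tofrac 'X^k.

Definition laurent_unit (x : {fraction {poly int}}) : Prop :=
  is_laurent x /\ exists2 y, is_laurent y & x * y = 1.

Definition laurent_irreducible (x : {fraction {poly int}}) : Prop :=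
  [/\ is_laurent x, x <> 0, ~ laurent_unit x &
      forall y z, is_laurent y -> is_laurent z -> x = y * z ->
        laurent_unit y \/ laurent_unit z].

(* [sigma_bar n] is the n-th power of the shift. *)
Definition sigma_bar (V : Type) (n : int) (w : int -> V) : int -> V :=
  fun k => w (k + n).

(* f(sigma_bar) w. *)
Definition poly_shift (V : zmodType) (f : {poly int}) (w : int -> V) :
  int -> V := fun k => \sum_(j < size f) w (k + j%:Z) *~ f`_j.

Definition bounded_seq (K : numDomainType) (w : int -> K) : Prop :=
  exists M : K, forall n, `|w n| <= M.

Lemma bounded_sigma (K : numDomainType) n (w : int -> K) :
  bounded_seq w -> bounded_seq (sigma_bar n w).
Proof. by case=> M wM; exists M => k; exact: wM. Qed.

Lemma poly_shift_sigma (V : zmodType) f n (w : int -> V) k :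
  poly_shift f (sigma_bar n w) k = poly_shift f w (k + n).
Proof. by apply: eq_bigr => j _; rewrite /sigma_bar addrAC. Qed.

Lemma poly_shift0 (V : zmodType) f k : poly_shift f (fun=> 0 : V) k = 0.
Proof. by apply: big1 => j _; rewrite mul0rz. Qed.

(* T = R / Z, with the quotient group structure and the quotient topology. *)
Definition integers (R : realType) : zmodClosed R :=
  GRing.ZmodClosed.clone R (@Num.int_num_subdef R) _.

Definition circle (R : realType) : Type :=
  quotient_topology {ideal_quot integers R}.
HB.instance Definition _ (R : realType) := Topological.on (circle R).
HB.instance Definition _ (R : realType) := Quotient.on (circle R).
HB.instance Definition _ (R : realType) :=
  GRing.Zmodule.copy (circle R) {ideal_quot integers R}.

Definition rho (R : realType) (w : int -> R) : {ptws int -> circle R} :=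
  fun n => (\pi_(circle R) (w n))%qT.

(* The Borel sigma-algebra of a topological space. *)
Definition borel (T : ptopologicalType) := g_sigma_algebraType (@open T).

Section Roots.
Variables (R : realType) (f : {poly int}).

Definition cpoly : {poly R[i]} := map_poly intr f.

Definition Omega : set R[i] := [set z | root cpoly z].
Definition Omega_minus : set R[i] := [set z | Omega z /\ `|z| < 1].
Definition Omega_zero : set R[i] := [set z | Omega z /\ `|z| = 1].
Definition Omega_plus : set R[i] := [set z | Omega z /\ 1 < `|z|].

Definition nonhyperbolic : Prop := Omega_zero !=set0.
Definition cyclotomic : Prop :=
  exists2 z, Omega_zero z & exists2 n : nat, (0 < n)%N & z ^+ n = 1.

(* This determines b on Omega, f having simple roots when it is irreducible. *)
Definition partial_fraction (b : R[i] -> R[i]) : Prop :=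
  forall u : R[i], ~ Omega u ->
    (cpoly.[u])^-1 = (lead_coef cpoly)^-1 * \sum_(w \in Omega) (b w / (u - w)).

End Roots.

Section Spaces.
Variables (R : realType) (f : {poly int}).

Definition Xset : set {ptws int -> circle R} :=
  [set x | forall k, poly_shift f x k = 0].
Definition X : Type := Xset.
HB.instance Definition _ := Topological.on X.

Lemma Xset0 : (fun=> 0) \in Xset.
Proof. by apply/mem_set => k; exact: poly_shift0. Qed.
HB.instance Definition _ := isPointed.Build X
  (exist (fun x => x \in Xset) _ Xset0).

Lemma alpha_subproof (x : X) : sigma_bar 1 (val x) \in Xset.
Proof.
case: x => x /= /set_mem xX; apply/mem_set => k.
by rewrite poly_shift_sigma; exact: xX.
Qed.
Definition alpha (x : X) : X :=
  exist (fun x => x \in Xset) _ (alpha_subproof x).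

(* Any Hausdorff vector space topology on the finite-dimensional space W0, in
   particular that of coordinatewise convergence, is the usual one. *)
Definition W0set : set {ptws int -> R} :=
  [set w | bounded_seq w /\ forall k, poly_shift f w k = 0].
Definition W0 : Type := W0set.
HB.instance Definition _ := Topological.on W0.

Lemma W0set0 : (fun=> 0) \in W0set.
Proof.
apply/mem_set; split=> [|k]; last exact: poly_shift0.
by exists 0 => n; rewrite normr0.
Qed.
HB.instance Definition _ := isPointed.Build W0
  (exist (fun x => x \in W0set) _ W0set0).

Definition X0 : set {ptws int -> circle R} := @rho R @` W0set.

Definition central_pair (p : X * X) : Prop :=
  X0 (fun n => val p.1 n - val p.2 n).

End Spaces.

Definition linf_int_set : set {ptws int -> discrete_topology int} :=
  [set v | bounded_seq (v : int -> int)].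
Definition linf_int : Type := linf_int_set.
HB.instance Definition _ := Topological.on linf_int.

Lemma linf_int_set0 : (fun=> 0 : int) \in linf_int_set.
Proof. by apply/mem_set; exists 0 => n; rewrite normr0. Qed.
HB.instance Definition _ := isPointed.Build linf_int
  (exist (fun x => x \in linf_int_set) _ linf_int_set0).

Lemma linf_shift_subproof (v : linf_int) :
  sigma_bar 1 (val v) \in linf_int_set.
Proof. by case: v => v /= /set_mem ?; apply/mem_set/bounded_sigma. Qed.
Definition linf_shift (v : linf_int) : linf_int :=
  exist (fun v => v \in linf_int_set) _ (linf_shift_subproof v).

Definition Ytilde (R : realType) (f : {poly int}) : Type :=
  (linf_int * W0 R f)%type.
HB.instance Definition _ R f := Topological.on (Ytilde R f).
HB.instance Definition _ R f := Pointed.on (Ytilde R f).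

Section Lifts.
Variables (R : realType) (f : {poly int}) (b : R[i] -> R[i]).

Definition residue_sum (A : set R[i]) (n : int) : R[i] :=
  (lead_coef (cpoly R f))^-1 * \sum_(w \in A) (b w * w ^ (n - 1)).

(* The sets summed over and the b_w are stable under complex conjugation, so
   that these sums are real and Re is only a change of type. *)
Definition w_plus (n : int) : R :=
  complex.Re (if 1 <= n then residue_sum (Omega_minus f) n
              else - residue_sum (Omega_zero f `|` Omega_plus f) n).
Definition w_minus (n : int) : R :=
  complex.Re (if 1 <= n then residue_sum (Omega_minus f `|` Omega_zero f) n
              else - residue_sum (Omega_plus f) n).

(* [Negz n] is - (n + 1): the second series runs over the negative indices. *)
Definition xi_star (v : int -> int) (k : int) : R :=
  limn (series (fun n : nat => (v n%:Z)%:~R * w_minus (k - n%:Z))) +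
  limn (series (fun n : nat => (v (Negz n))%:~R * w_plus (k - Negz n))).

Definition cocycle (n : int) (v : int -> int) (k : int) : R :=
  sigma_bar n (xi_star v) k - xi_star (sigma_bar n v) k.

(* Under the standing assumptions on f and b, the sequences given to insubd in
   the next two definitions do belong to W0set and to Xset, so that its default
   value is never used. *)
Definition sigma_tilde (y : Ytilde R f) : Ytilde R f :=
  (linf_shift y.1,
   insubd (point : W0 R f)
     (fun k => sigma_bar 1 (val y.2) k + cocycle 1 (val y.1) k)).

Definition xi_tilde (y : Ytilde R f) : X R f :=
  insubd (point : X R f) (rho (fun k => xi_star (val y.1) k + val y.2 k)).

End Lifts.

Section Measures.
Variable R : realType.

Definition invariant_measure d (T : measurableType d) (mu : set T -> \bar R)
    (g : T -> T) : Prop :=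
  forall A, measurable A -> pushforward mu g A = mu A.

(* Measures enter as set functions in order to apply this to a push-forward;
   only their values on measurable sets matter. *)
Definition centrally_equivalent (f : {poly int})
    (mu1 mu2 : set (borel (X R f)) -> \bar R) : Prop :=
  exists varrho : probability (borel (X R f) * borel (X R f))%type R,
    [/\ invariant_measure varrho
          (fun p => (alpha (p.1 : X R f), alpha (p.2 : X R f))),
        forall A, measurable A -> pushforward varrho fst A = mu1 A,
        forall A, measurable A -> pushforward varrho snd A = mu2 A &
        {ae varrho, forall p, central_pair p}].

Definition compactly_supported (T : ptopologicalType)
    (nu : set (borel T) -> \bar R) : Prop :=
  exists2 K : set T, compact K & nu (~` K) = 0%E.

End Measures.

(* Main.v *)
Require Import Defs.
From HB Require Import structures.
From mathcomp Require Import all_boot all_order all_algebra.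
From mathcomp Require Import fraction complex.
From mathcomp Require Import all_classical all_reals all_analysis.
From mathcomp Require Import measurable_realfun.
From mathcomp Require Import zify ring lra.
Import numFieldNormedType.Exports.
Import Order.TTheory GRing.Theory Num.Theory.
Set Implicit Arguments.
Unset Strict Implicit.
Unset Printing Implicit Defensive.
Local Open Scope classical_set_scope.
Local Open Scope ring_scope.

(** The reduction from invariant measures on X to invariant measures on Ytilde
    is carried out by a Borel section of the factor map xi_tilde that commutes
    with the dynamics.  Given x in X, let [lift x] be its coordinatewise
    representative in [0, 1[.  Since x satisfies the recursion defined by f
    modulo 1, the real sequence f(sigma) (lift x) is integral; call it
    [digits x].  It is bounded by the l^1-norm of f, uniformly in x.  The
    sequences w^Delta+ and w^Delta- are both fundamental solutions,
    f(sigma) w = delta_0, so f(sigma) xi^*(v) = v for every bounded v, and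
    [offset x] = lift x - xi^*(digits x) lies in the kernel of f(sigma).

    Elements of this kernel which do not grow exponentially are bounded: the
    partial fraction decomposition writes a kernel element as a combination of
    geometric sequences with ratios the roots of f, and only the ratios of
    modulus 1 survive.  Hence x |-> (digits x, offset x) takes its values in
    Ytilde, and the cocycle in the definition of sigma_tilde is exactly what
    makes this map equivariant ([lifting_alpha]), while
    xi_tilde (digits x, offset x) = rho (lift x) = x by construction
    ([liftingK]).  The image of mu under this map is therefore an invariant
    measure whose push-forward by xi_tilde is mu itself, and the diagonal
    measure on X * X witnesses the central equivalence.

    Two points need quantitative control.  All bounds use a single rate t > 1,
    smaller than |a| or 1 / |a| for every root a off the unit circle: w^Delta-
    is O(t^n) and w^Delta+ is O(t^-n) on all of Z, which at once gives the
    convergence of the series defining xi^*, the bound O(t^k + t^-k) on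
    xi^*(v), and a bound on [offset x] that does not depend on x
    ([offset_bound]).  By the last fact the section takes its values in a
    product of two compact sets ([lifting_compact]).  Borel measurability
    ([measurable_lifting]) is checked on coordinates, the topology of Ytilde
    having a countable network of cylinders. *)

(** * Polynomials in the shift acting on two-sided sequences *)

Section PolynomialShift.
Context {K : comNzRingType}.
Implicit Types (p q : {poly K}) (w y : int -> K).

Definition pshift p w (k : int) : K := \sum_(j < size p) p`_j * w (k + j%:Z).

Lemma pshift_widen n p w k : (size p <= n)%N ->
  pshift p w k = \sum_(j < n) p`_j * w (k + j%:Z).
Proof.
move=> pn; rewrite /pshift (big_ord_widen n (fun j => p`_j * w (k + j%:Z))) //.
rewrite big_mkcond; apply: eq_bigr => j _.
by case: ltnP => // pj; rewrite nth_default ?mul0r.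
Qed.

Lemma pshiftD p q w k : pshift (p + q) w k = pshift p w k + pshift q w k.
Proof.
have pn : (size p <= maxn (size p) (size q))%N by rewrite leq_maxl.
have qn : (size q <= maxn (size p) (size q))%N by rewrite leq_maxr.
rewrite (pshift_widen _ _ (size_polyD p q)) (pshift_widen _ _ pn).
rewrite (pshift_widen _ _ qn) -big_split /=.
by apply: eq_bigr => j _; rewrite coefD mulrDl.
Qed.

Lemma pshiftC a w k : pshift a%:P w k = a * w k.
Proof.
rewrite (@pshift_widen 1) ?size_polyC ?leq_b1 // big_ord1.
by rewrite coefC /= addr0.
Qed.

Lemma pshiftZ a p w k : pshift (a *: p) w k = a * pshift p w k.
Proof.
rewrite (pshift_widen _ _ (size_scale_leq a p)) mulr_sumr.
by apply: eq_bigr => j _; rewrite coefZ mulrA.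
Qed.

Lemma pshift_sum I (r : seq I) (c : I -> K) (P : I -> {poly K}) w k :
  pshift (\sum_(i <- r) c i *: P i) w k = \sum_(i <- r) c i * pshift (P i) w k.
Proof.
elim/big_ind2: _ => [|_ p _ q <- <-|i _].
- by rewrite -[0]/(0%:P) pshiftC mul0r.
- by rewrite pshiftD.
- by rewrite pshiftZ.
Qed.

Lemma pshift_comb p I (r : seq I) (c : I -> K) (w : I -> int -> K) k :
  pshift p (fun n => \sum_(i <- r) c i * w i n) k =
  \sum_(i <- r) c i * pshift p (w i) k.
Proof.
rewrite /pshift; under eq_bigr do rewrite mulr_sumr.
rewrite exchange_big /=; apply: eq_bigr => i _; rewrite mulr_sumr.
by apply: eq_bigr => j _; rewrite mulrCA.
Qed.

Lemma eq_pshift p w y k : w =1 y -> pshift p w k = pshift p y k.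
Proof. by move=> wy; apply: eq_bigr => j _; rewrite wy. Qed.

Lemma pshift_mulX p w k : pshift (p * 'X) w k = pshift p w (k + 1).
Proof.
rewrite (@pshift_widen (size p).+1); last first.
  by rewrite (leq_trans (size_polyMleq _ _)) // size_polyX addn2.
rewrite big_ord_recl coefMX /= mul0r add0r; apply: eq_bigr => j _.
by rewrite coefMX /= /bump leq0n add1n intS addrA.
Qed.

Lemma pshift_mul_XsubC p a w k :
  pshift (p * ('X - a%:P)) w k = pshift p w (k + 1) - a * pshift p w k.
Proof.
rewrite mulrBr pshiftD pshift_mulX; congr (_ + _).
by rewrite mulrC mul_polyC -scaleNr pshiftZ mulNr.
Qed.

Lemma pshift_XsubC_comp p a w k :
  pshift (p * ('X - a%:P)) w k = pshift p (fun n => w (n + 1) - a * w n) k.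
Proof.
rewrite pshift_mul_XsubC /pshift mulr_sumr -sumrB.
by apply: eq_bigr => j _; rewrite addrAC mulrBr mulrCA.
Qed.

End PolynomialShift.

(** * Partial fractions *)

Section ResidueIdentity.
Variables (R : realType) (f : {poly int}).
Hypothesis f_neq0 : f != 0.

Local Notation F := (cpoly R f).
Local Notation lc := (lead_coef F).

Definition roots : seq R[i] := finmap.enum_fset (fset_set (@Omega R f)).

Lemma cpoly_neq0 : F != 0.
Proof. by rewrite map_poly_eq0_id0 // intr_eq0 lead_coef_eq0. Qed.

Lemma lead_cpoly_neq0 : lc != 0.
Proof. by rewrite lead_coef_eq0 cpoly_neq0. Qed.

Lemma finite_Omega : finite_set (Omega (R := R) f).
Proof.
have [s sP] : {s : seq R[i] | forall z, root F z -> z \in s}.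
  have [s Fs] := closed_field_poly_normal F; exists s => z.
  by rewrite Fs rootZ ?lead_cpoly_neq0 // root_prod_XsubC.
apply: (@sub_finite_set _ _ [set` s]); last exact: finite_seq.
by move=> z /= Fz; apply: sP.
Qed.

Lemma mem_roots z : (z \in roots) = root F z.
Proof.
by rewrite /roots in_fset_set ?inE; [exact: asboolb | exact: finite_Omega].
Qed.

Definition cofactor_poly (a : R[i]) : {poly R[i]} := F %/ ('X - a%:P).

Lemma cofactor_polyK a : a \in roots -> F = cofactor_poly a * ('X - a%:P).
Proof. by rewrite mem_roots -dvdp_XsubCl => /divpK. Qed.

Variable b : R[i] -> R[i].
Hypothesis b_def : partial_fraction f b.

(** The partial fraction decomposition of 1 / f multiplied by f: the two sides
    agree away from the finitely many roots of f, hence as polynomials. *)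
Lemma sum_cofactor_poly :
  \sum_(a <- roots) b a *: cofactor_poly a = lc%:P.
Proof.
apply/eqP; rewrite -subr_eq0; apply/negPn/negP => D0.
set D := _ - _ in D0.
have DF0 : D * F != 0 by rewrite mulf_neq0 ?cpoly_neq0.
have [s Ds] : {s : seq R[i] | forall z, root (D * F) z -> z \in s}.
  have [s Fs] := closed_field_poly_normal (D * F); exists s => z.
  by rewrite Fs rootZ ?lead_coef_eq0 // root_prod_XsubC.
(* F kills the roots of F, D vanishes elsewhere: too many roots for D * F. *)
suff : forall z, root (D * F) z.
  move=> all_root.
  pose t := [seq (n%:R : R[i]) | n <- iota 0 (size s).+1].
  have ut : uniq t by rewrite map_inj_uniq ?iota_uniq // => m n /eqP;
    rewrite eqr_nat => /eqP.
  have /(uniq_leq_size ut) : {subset t <= s} by move=> z _; apply: Ds.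
  by rewrite size_map size_iota ltnn.
move=> z; rewrite rootM orbC; have [//|/= Fz] := boolP (root F z).
rewrite /root /D hornerD hornerN hornerC horner_sum subr_eq0; apply/eqP.
have Fz0 : F.[z] != 0 by [].
have := b_def (u := z); rewrite fsbig_finite; last exact: finite_Omega.
move=> /(_ (negP Fz)) /(congr1 (fun x => lc * F.[z] * x)).
rewrite mulfK // => ->; rewrite mulrACA mulfV ?lead_cpoly_neq0 // mul1r.
rewrite mulr_sumr; apply: eq_big_seq => a ar.
have za : z - a != 0.
  by rewrite subr_eq0; apply: contraNneq Fz => ->; rewrite -mem_roots.
rewrite hornerZ (cofactor_polyK ar) hornerM hornerXsubC.
by field.
Qed.

(** Spectral decomposition of a sequence: when f(sigma) w = 0, the summand of
    index a is a geometric sequence of ratio a. *)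
Lemma pshift_sum_residue (w : int -> R[i]) k :
  w k = \sum_(a <- roots) lc^-1 * b a * pshift (cofactor_poly a) w k.
Proof.
under eq_bigr do rewrite -mulrA; rewrite -mulr_sumr -pshift_sum.
by rewrite sum_cofactor_poly pshiftC mulKf // lead_cpoly_neq0.
Qed.

(** Superposing, with the residues of 1 / f as weights, solutions of the
    first-order equations (sigma - a) y_a = delta_0 solves
    f(sigma) w = delta_0, since f(sigma) y_a is the image of delta_0 under the
    cofactor of the root a.  The choice of y_a is free for each root, which
    covers both homoclinic points. *)
Lemma pshift_fundamental (y : R[i] -> int -> R[i]) :
  (forall a, a \in roots -> forall n, y a (n + 1) - a * y a n = (n == 0)%:R) ->
  forall k, pshift F (fun n => lc^-1 * \sum_(a <- roots) b a * y a n) k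
    = (k == 0)%:R.
Proof.
move=> yP k; rewrite (pshift_sum_residue (fun k => (k == 0)%:R)).
under eq_pshift do rewrite mulr_sumr; under eq_pshift do
  under eq_bigr do rewrite mulrA.
rewrite pshift_comb; apply: eq_big_seq => a ar; congr (_ * _).
rewrite [F in LHS](cofactor_polyK ar) pshift_XsubC_comp.
by apply: eq_pshift => n; rewrite yP.
Qed.

End ResidueIdentity.

(** * The modulus of a complex number as a real number *)

Section ComplexModulus.
Variable R : realType.
Implicit Types (z : R[i]).

Definition modc z : R := complex.Re `|z|.

Lemma modcE z : `|z| = (modc z)%:C%C.
Proof. by rewrite /modc normc_def. Qed.

Lemma modc_ge0 z : 0 <= modc z.
Proof. by rewrite -lecR -modcE normr_ge0. Qed.

Lemma modcM : {morph modc : y z / y * z}.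
Proof. by move=> y z; apply: complexI; rewrite rmorphM /= -!modcE normrM. Qed.

Lemma modc_real (x : R) : modc x%:C%C = `|x|.
Proof. by apply: complexI; rewrite -modcE normc_def /= expr0n addr0 sqrtr_sqr. Qed.

Lemma modc0 : modc 0 = 0.
Proof. by rewrite (modc_real 0) normr0. Qed.

Lemma modc1 : modc 1 = 1.
Proof. by rewrite (modc_real 1) normr1. Qed.

Lemma modcN z : modc (- z) = modc z.
Proof. by rewrite /modc normrN. Qed.

Lemma modcV z : modc z^-1 = (modc z)^-1.
Proof. by apply: complexI; rewrite fmorphV /= -!modcE normfV. Qed.

Lemma modcXz z (n : int) : modc (z ^ n) = modc z ^ n.
Proof.
have modcX m : modc (z ^+ m) = modc z ^+ m.
  by elim: m => [|m IH]; rewrite ?expr0 ?modc1 // !exprS modcM IH.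
by case: n => n; rewrite ?NegzE -?exprnN -?exprnP ?modcV modcX.
Qed.

Lemma modc_eq0 z : (modc z == 0) = (z == 0).
Proof. by rewrite -(inj_eq (@complexI R)) -modcE normr_eq0. Qed.

Lemma modc_gt0 z : (0 < modc z) = (z != 0).
Proof. by rewrite lt0r modc_eq0 modc_ge0 andbT. Qed.

Lemma modc_lt1 z : (modc z < 1) = (`|z| < 1).
Proof. by rewrite -ltcR -modcE. Qed.

Lemma modc_le1 z : (modc z <= 1) = (`|z| <= 1).
Proof. by rewrite -lecR -modcE. Qed.

Lemma ler_modcD y z : modc (y + z) <= modc y + modc z.
Proof. by rewrite -lecR rmorphD /= -!modcE ler_normD. Qed.

Lemma ler_modc_sum I (r : seq I) (F : I -> R[i]) :
  modc (\sum_(i <- r) F i) <= \sum_(i <- r) modc (F i).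
Proof.
elim/big_ind2: _ => [|y a z c ya zc|//]; first by rewrite modc0.
exact: le_trans (ler_modcD _ _) (lerD ya zc).
Qed.

Lemma ler_Re_modc z : `|complex.Re z| <= modc z.
Proof. by rewrite -lecR -modcE normc_ge_Re. Qed.

End ComplexModulus.

(** * Exponential growth rates *)

Section Growth.
Variable R : realType.
Implicit Types (t : R) (k : int).

Definition growth t k : R := t ^ k + t ^ (- k).

(** The strict inequalities leave room for comparing the geometric growth of
    powers of a with that of powers of t. *)
Lemma exists_rate (s : seq R[i]) : exists2 t : R, 1 < t &
  forall a, a \in s -> a != 0 ->
    (1 < modc a -> t < modc a) /\ (modc a < 1 -> t < (modc a)^-1).
Proof.
elim: s => [|a s [t t1 tP]]; first by exists 2 => //; rewrite ltr1n.
pose m := Num.max (modc a) (modc a)^-1.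
pose t' := if 1 < m then Num.min t ((1 + m) / 2) else t.
have t't : t' <= t by rewrite /t'; case: ifP => //; rewrite ge_min lexx.
have t'm : 1 < m -> t' < m.
  by move=> m1; rewrite /t' m1 gt_min; apply/orP; right; lra.
exists t'.
  by rewrite /t'; case: ifP => // m1; rewrite lt_min t1; lra.
move=> c; rewrite inE => /orP[/eqP ->|cs] c0; last first.
  have [tc1 tc2] := tP c cs c0.
  by split=> h; apply: (le_lt_trans t't); [apply: tc1|apply: tc2].
have a0 : 0 < modc a by rewrite modc_gt0.
split=> h.
  have mE : m = modc a.
    by apply/max_idPl; rewrite (le_trans _ (ltW h)) // invf_le1 // ltW.
  by rewrite -mE; apply: t'm; rewrite mE.
have h' : 1 < (modc a)^-1 by rewrite invf_gt1.
have mE : m = (modc a)^-1 by apply/max_idPr; rewrite (le_trans (ltW h)) // ltW.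
by rewrite -mE; apply: t'm; rewrite mE.
Qed.

Lemma growth_shift t k (j : nat) : 1 <= t ->
  growth t (k + j%:Z) <= t ^+ j * growth t k.
Proof.
move=> t1; have t0 : 0 < t by rewrite (lt_le_trans _ t1).
rewrite /growth mulrDr exprnP -!expfzDr ?gt_eqF // [(j%:Z + k)%R]addrC lerD2l.
by rewrite ler_weXz2l //; lia.
Qed.

Lemma growth0 t : growth t 0 = 2.
Proof. by rewrite /growth oppr0 expr0z. Qed.

Lemma eq0_of_geometric_bound (q t A c : R) : 0 < t -> t < q -> 0 <= c ->
  (forall n : nat, q ^+ n * c <= A * t ^+ n) -> c = 0.
Proof.
move=> t0 tq c0 cA; apply/eqP; rewrite eq_le c0 andbT.
have q0 : 0 < q by rewrite (lt_trans t0).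
have r1 : `|t / q| < 1.
  by rewrite ger0_norm ?divr_ge0 ?ltW // ltr_pdivrMr // mul1r.
have h : (fun n => A * (t / q) ^+ n) @ \oo --> A * 0.
  by apply: cvgMl_tmp; exact: cvg_expr.
rewrite -[leRHS](mulr0 A) -(cvg_lim _ h) //.
apply: limr_ge; first by apply/cvg_ex; eexists; exact: h.
apply: nearW => n; rewrite expr_div_n mulrA ler_pdivlMr ?exprn_gt0 //.
by rewrite mulrC.
Qed.

Lemma geometric_series_bound (u : nat -> R) (A q : R) : 0 <= q -> q < 1 ->
  (forall n, `|u n| <= A * q ^+ n) ->
  cvgn (series u) /\ `|limn (series u)| <= A / (1 - q).
Proof.
move=> q0 q1 uA.
have nq : `|q| < 1 by rewrite ger0_norm.
have cg : cvgn (series (geometric A q)) by exact: is_cvg_geometric_series.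
have A0 : 0 <= A.
  by apply: le_trans (normr_ge0 (u 0)) _; rewrite -[leRHS]mulr1 -(expr0 q).
have cn : cvgn [normed series u].
  apply: series_le_cvg cg => n //=; first by rewrite mulr_ge0 ?exprn_ge0.
split; first exact: normed_cvg.
apply: le_trans (lim_series_norm cn) _.
rewrite -(cvg_lim _ (@cvg_geometric_series _ A q nq)) //.
exact: lim_series_le.
Qed.

End Growth.

(** * Bounded fundamental solutions of the recursion *)

Section FundamentalSolutions.
Variables (R : realType) (f : {poly int}) (b : R[i] -> R[i]).
Hypothesis f_cst : f`_0 != 0.
Hypothesis b_def : partial_fraction f b.

Local Notation F := (cpoly R f).
Local Notation lc := (lead_coef F).

Lemma cst_neq0_poly_neq0 : f != 0.
Proof. by apply: contraNneq f_cst => ->; rewrite coef0. Qed.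
Let f_neq0 := cst_neq0_poly_neq0.

Lemma root_cpoly_neq0 a : a \in roots R f -> a != 0.
Proof.
rewrite mem_roots //; apply: contraTneq => ->.
by rewrite rootE horner_coef0 coef_map /= intr_eq0.
Qed.

Lemma Re_pshift_cpoly (z : int -> R[i]) k :
  complex.Re (pshift F z k) = poly_shift f (fun n => complex.Re (z n)) k.
Proof.
rewrite /poly_shift (@pshift_widen _ (size f)) ?size_poly //.
have ReD (x y : R[i]) : complex.Re (x + y) = complex.Re x + complex.Re y.
  by case: x y => ? ? [].
rewrite (big_morph _ ReD (erefl _)); apply: eq_bigr => j _.
rewrite coef_map /= -(rmorph_int (real_complex R)) -[RHS]mulrzl.
by case: (z _) => x y /=; rewrite mul0r subr0.
Qed.

Lemma pshift_cpoly_real (w : int -> R) k :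
  pshift F (fun n => (w n)%:C%C) k = (poly_shift f w k)%:C%C.
Proof.
rewrite /poly_shift (@pshift_widen _ (size f)) ?size_poly // rmorph_sum /=.
apply: eq_bigr => j _.
by rewrite coef_map /= -[X in _ = X%:C%C]mulrzl rmorphM /= rmorph_int.
Qed.

(** The solution of (sigma - a) y = delta_0 supported by the positive integers
    if P holds, by the others if not. *)
Definition one_sided (P : bool) (a : R[i]) (n : int) : R[i] :=
  if 1 <= n then (if P then a ^ (n - 1) else 0)
  else (if P then 0 else - a ^ (n - 1)).

Lemma one_sided_rec P a n : a != 0 ->
  one_sided P a (n + 1) - a * one_sided P a n = (n == 0)%:R.
Proof.
move=> a0; have aS : a * a ^ (n - 1) = a ^ n.
  by rewrite -{1}[a]expr1z -expfzDr // addrC subrK.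
rewrite /one_sided addrK; have [n0|n0] := eqVneq n 0.
  by rewrite n0 /=; case: P; rewrite ?mulr0 ?subr0 // add0r mulrN opprK mulfV.
have -> : (1 <= n + 1) = (1 <= n) by apply/idP/idP; lia.
by case: ifP => _; case: P; rewrite ?mulrN ?aS ?opprK ?mulr0 ?addNr ?subrr.
Qed.

(** Common form of w^Delta- and w^Delta+: P selects the roots whose geometric
    sequence is put on the positive side.  The two points differ only by the
    side given to the roots on the unit circle. *)
Definition fundamental (P : pred R[i]) (n : int) : R :=
  complex.Re (lc^-1 * \sum_(a <- roots R f) b a * one_sided (P a) a n).

Lemma poly_shift_fundamental P k : poly_shift f (fundamental P) k = (k == 0)%:R.
Proof.
rewrite -Re_pshift_cpoly (pshift_fundamental f_neq0 b_def).
  by case: (k == 0).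
by move=> a ar n; apply: one_sided_rec; exact: root_cpoly_neq0.
Qed.

Lemma residue_sum_roots (A : set R[i]) n : A `<=` Omega f ->
  residue_sum f b A n =
  lc^-1 * \sum_(a <- roots R f) b a * (if a \in A then a ^ (n - 1) else 0).
Proof.
move=> AO; have -> : A = Omega f `&` A by rewrite setIidr.
rewrite /residue_sum fsbig_mkcondr fsbig_finite; last exact: finite_Omega.
congr (_ * _); apply: eq_big_seq => a; rewrite mem_roots // => ar.
by rewrite in_setI [_ \in Omega f]mem_set //=; case: ifP; rewrite ?mulr0.
Qed.

Lemma w_minusE n : w_minus f b n = fundamental (fun a => `|a| <= 1) n.
Proof.
rewrite /w_minus /fundamental; congr complex.Re; case: ifP => n1.
  rewrite residue_sum_roots; last by move=> z [] [].
  congr (_ * _); apply: eq_big_seq => a; rewrite mem_roots // => ar.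
  rewrite /one_sided n1; congr (_ * _); congr (if _ then _ else _).
  apply/idP/idP => [|a1].
    by rewrite inE => -[[_ /ltW]|[_ ->]].
  by rewrite inE; move: a1; rewrite le_eqVlt => /orP[/eqP ?|?]; [right|left].
rewrite residue_sum_roots; last by move=> z [].
rewrite -mulrN -sumrN; congr (_ * _); apply: eq_big_seq => a.
rewrite mem_roots // => ar; rewrite /one_sided n1 -mulrN; congr (_ * _).
have -> : (a \in Omega_plus f) = ~~ (`|a| <= 1).
  rewrite modcE -[1]/((1 : R)%:C%C) lecR -ltNge -ltcR -modcE.
  by apply/idP/idP; rewrite inE; [case|split].
by case: (_ <= _); rewrite ?oppr0.
Qed.

Lemma w_plusE n : w_plus f b n = fundamental (fun a => `|a| < 1) n.
Proof.
rewrite /w_plus /fundamental; congr complex.Re; case: ifP => n1.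
  rewrite residue_sum_roots; last by move=> z [].
  congr (_ * _); apply: eq_big_seq => a; rewrite mem_roots // => ar.
  rewrite /one_sided n1; congr (_ * _); congr (if _ then _ else _).
  by apply/idP/idP; rewrite inE; [case|split].
rewrite residue_sum_roots; last by move=> z [] [].
rewrite -mulrN -sumrN; congr (_ * _); apply: eq_big_seq => a.
rewrite mem_roots // => ar; rewrite /one_sided n1 -mulrN; congr (_ * _).
have -> : (a \in Omega_zero f `|` Omega_plus f) = ~~ (`|a| < 1).
  rewrite modcE -[1]/((1 : R)%:C%C) ltcR -leNgt -lecR -modcE.
  apply/idP/idP => [|a1].
    by rewrite inE => -[[_ ->]|[_ /ltW]].
  by rewrite inE; move: a1; rewrite le_eqVlt => /orP[/eqP ?|?]; [left|right].
by case: (_ < _); rewrite ?oppr0.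
Qed.

Definition fundamental_cst : R :=
  \sum_(a <- roots R f) modc (lc^-1 * b a) * (modc a)^-1.

Lemma fundamental_cst_ge0 : 0 <= fundamental_cst.
Proof. by apply: sumr_ge0 => a _; rewrite mulr_ge0 ?invr_ge0 ?modc_ge0. Qed.

(** At n, only the roots put on the side of n contribute to w_n. *)
Lemma fundamental_bound P (n : int) (u : R) :
  (forall a, a \in roots R f -> (P a) = (1 <= n) -> modc a ^ n <= u) -> 0 <= u ->
  `|fundamental P n| <= fundamental_cst * u.
Proof.
move=> Pu u0; apply: le_trans (ler_Re_modc _) _.
rewrite mulr_sumr; apply: le_trans (ler_modc_sum _ _) _.
rewrite /fundamental_cst mulr_suml big_seq [leRHS]big_seq.
apply: ler_sum => a ar; have a0 := root_cpoly_neq0 ar.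
rewrite mulrA modcM -mulrA ler_wpM2l ?modc_ge0 //.
have [Pa|Pa] := eqVneq (P a) (1 <= n); last first.
  suff -> : one_sided (P a) a n = 0.
    by rewrite modc0 mulr_ge0 ?invr_ge0 ?modc_ge0.
  by move: Pa; rewrite /one_sided; case: ifP; case: (P a).
have -> : modc (one_sided (P a) a n) = (modc a)^-1 * modc a ^ n.
  have aE : a ^ (n - 1) = a^-1 * a ^ n by rewrite expfzDr // exprN1 mulrC.
  rewrite /one_sided Pa.
  by case: (1 <= n); rewrite ?modcN aE modcM modcV modcXz.
by rewrite ler_wpM2l ?invr_ge0 ?modc_ge0 ?Pu.
Qed.

Definition is_rate (t : R) : Prop := 1 < t /\
  forall a, a \in roots R f ->
    (1 < modc a -> t < modc a) /\ (modc a < 1 -> t < (modc a)^-1).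

Lemma is_rate_exists : exists t, is_rate t.
Proof.
have [t t1 tP] := exists_rate (roots R f).
by exists t; split=> // a ar; apply: tP => //; exact: root_cpoly_neq0.
Qed.

(** w^Delta- is bounded for n >= 1, where t^n >= 1, and decays at least like
    t^n as n tends to -oo. *)
Lemma w_minus_bound t n : is_rate t -> `|w_minus f b n| <= fundamental_cst * t ^ n.
Proof.
case=> t1 tP; have t0 : 0 < t by rewrite (lt_trans _ t1).
rewrite w_minusE; apply: fundamental_bound; last by rewrite exprz_ge0 // ltW.
move=> a ar; have a0 : 0 < modc a by rewrite modc_gt0 root_cpoly_neq0.
case: (lerP 1 n) => n1; rewrite -modc_le1 => a1.
  apply: (@le_trans _ _ 1); last by rewrite -(expr0z t) ler_weXz2l ?(ltW t1) //; lia.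
  by rewrite -(exp1rz _ n) ler_wpXz2r ?nnegrE ?modc_ge0 //; lia.
have n0 : n <= 0 by lia.
by rewrite ler_wnXz2r ?posrE //; apply/ltW/(tP a ar).1; rewrite ltNge a1.
Qed.

(** The mirror image of the estimate for w^Delta-: the roots on the unit circle
    are on the other side. *)
Lemma w_plus_bound t n : is_rate t -> `|w_plus f b n| <= fundamental_cst * t ^ (- n).
Proof.
case=> t1 tP; have t0 : 0 < t by rewrite (lt_trans _ t1).
rewrite w_plusE; apply: fundamental_bound; last by rewrite exprz_ge0 // ltW.
move=> a ar; have a0 : 0 < modc a by rewrite modc_gt0 root_cpoly_neq0.
case: (lerP 1 n) => n1; rewrite -modc_lt1 => a1.
  have n0 : 0 <= n by lia.
  rewrite -exprz_inv ler_wpXz2r ?nnegrE ?modc_ge0 ?invr_ge0 ?ltW //.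
  by rewrite -[ltLHS]invrK ltf_pV2 ?posrE ?invr_gt0 // (tP a ar).2.
apply: (@le_trans _ _ 1); last by rewrite -(expr0z t) ler_weXz2l ?(ltW t1) //; lia.
have n0 : n <= 0 by lia.
rewrite -(exp1rz _ n) ler_wnXz2r ?posrE //.
by rewrite leNgt a1.
Qed.

End FundamentalSolutions.

(** * Kernel elements of subexponential growth are bounded *)

Section Kernel.
Variables (R : realType) (f : {poly int}) (b : R[i] -> R[i]).
Hypothesis f_cst : f`_0 != 0.
Hypothesis b_def : partial_fraction f b.

Local Notation F := (cpoly R f).
Local Notation lc := (lead_coef F).
Let f_neq0 := cst_neq0_poly_neq0 f_cst.

Definition coef_bound (p : {poly R[i]}) (t : R) : R :=
  \sum_(j < size p) modc p`_j * t ^+ j.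

Lemma pshift_growth p (z : int -> R[i]) (t B : R) : 1 <= t -> 0 <= B ->
  (forall k, modc (z k) <= B * growth t k) ->
  forall k, modc (pshift p z k) <= B * coef_bound p t * growth t k.
Proof.
move=> t1 B0 zB k; apply: le_trans (ler_modc_sum _ _) _.
rewrite /coef_bound mulr_sumr mulr_suml; apply: ler_sum => j _.
rewrite modcM [B * _]mulrCA -mulrA ler_wpM2l ?modc_ge0 //.
apply: le_trans (zB _) _; rewrite -mulrA ler_wpM2l //.
exact: growth_shift.
Qed.

(** A geometric sequence with ratio off the unit circle outgrows t^k + t^-k in
    one direction, so it vanishes; on the unit circle its modulus is constant,
    equal to its value at 0. *)
Lemma geometric_growth_bound (t B : R) a (y : int -> R[i]) : is_rate f t ->
  a \in roots R f -> 0 <= B ->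
  (forall k, y (k + 1) = a * y k) ->
  (forall k, modc (y k) <= B * growth t k) ->
  forall k, modc (y k) <= B * 2.
Proof.
move=> [t1 tP] ar B0 yS yB; have t0 : 0 < t by rewrite (lt_trans _ t1).
have a0 := root_cpoly_neq0 f_cst ar; have ma0 : 0 < modc a by rewrite modc_gt0.
have aS (n : int) : a ^ (n + 1) = a * a ^ n by rewrite addrC expfzDr // expr1z.
have yE k : y k = a ^ k * y 0.
  elim: k => [|n IH|n IH]; first by rewrite expr0z mul1r.
    by rewrite intS addrC yS IH aS mulrA.
  have nS : - n.+1%:Z + 1 = - n%:Z by lia.
  by apply: (mulfI a0); rewrite -yS mulrA -aS nS.
have growth_le n : growth t n%:Z <= 2 * t ^+ n.
  by rewrite /growth mulrDl mul1r lerD2l exprnP ler_weXz2l ?(ltW t1) //; lia.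
have y0 : modc a != 1 -> y 0 = 0.
  rewrite neq_lt => /orP[a1|a1]; apply/eqP; rewrite -modc_eq0; apply/eqP.
    apply: (eq0_of_geometric_bound (A := B * 2) t0 ((tP a ar).2 a1)) => [|n].
      exact: modc_ge0.
    apply: (@le_trans _ _ (B * growth t (- n%:Z))).
      apply: le_trans (yB _); rewrite (yE (- n%:Z)) modcM modcXz.
      by rewrite exprnP exprz_inv.
    by rewrite -mulrA ler_wpM2l // /growth opprK addrC growth_le.
  apply: (eq0_of_geometric_bound (A := B * 2) t0 ((tP a ar).1 a1)) => [|n].
    exact: modc_ge0.
  apply: (@le_trans _ _ (B * growth t n%:Z)).
    by apply: le_trans (yB _); rewrite (yE n%:Z) modcM modcXz exprnP.
  by rewrite -mulrA ler_wpM2l // growth_le.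
move=> k; rewrite yE; have [a1|/y0 ->] := eqVneq (modc a) 1; last first.
  by rewrite mulr0 modc0 mulr_ge0.
rewrite modcM modcXz a1 exp1rz mul1r.
by apply: le_trans (yB _) _; rewrite growth0.
Qed.

Definition kernel_cst (t : R) : R :=
  \sum_(a <- roots R f) modc (lc^-1 * b a) * coef_bound (cofactor_poly f a) t * 2.

(** The bound is linear in B, with a constant depending only on f, b and t: this
    uniformity is what puts the section below in a compact set. *)
Lemma kernel_bound (t B : R) (w : int -> R) : is_rate f t -> 0 <= B ->
  (forall k, poly_shift f w k = 0) ->
  (forall k, `|w k| <= B * growth t k) ->
  forall k, `|w k| <= B * kernel_cst t.
Proof.
move=> tr B0 w0 wB k; have t1 : 1 <= t by apply/ltW/tr.1.
rewrite -modc_real (pshift_sum_residue f_neq0 b_def (fun k => (w k)%:C%C)).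
apply: le_trans (ler_modc_sum _ _) _; rewrite mulr_sumr.
rewrite big_seq [leRHS]big_seq; apply: ler_sum => a ar.
rewrite modcM -mulrA [B * _]mulrCA ler_wpM2l ?modc_ge0 // mulrA.
apply: (geometric_growth_bound (a := a) tr ar).
- rewrite mulr_ge0 ?sumr_ge0 // => j _.
  by rewrite mulr_ge0 ?modc_ge0 // exprn_ge0 // (le_trans _ t1).
- move=> n; apply/eqP; rewrite -subr_eq0 -pshift_mul_XsubC.
  by rewrite -(cofactor_polyK f_neq0 ar) pshift_cpoly_real w0.
- by apply: pshift_growth => // n; rewrite modc_real.
Qed.

End Kernel.

(** * The map xi^* *)

Section SymbolicMap.
Variables (R : realType) (f : {poly int}) (b : R[i] -> R[i]).
Hypothesis f_cst : f`_0 != 0.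
Hypothesis b_def : partial_fraction f b.

Let K := fundamental_cst f b.

Lemma cvg_poly_shift (T : Type) (G : set_system T) (u : T -> int -> R)
    (l : int -> R) k : Filter G ->
  (forall k, u x k @[x --> G] --> l k) ->
  poly_shift f (u x) k @[x --> G] --> poly_shift f l k.
Proof.
move=> GF ul; rewrite /poly_shift; apply: (cvg_big add_continuous) => j _.
by under eq_fun do rewrite -mulrzl; rewrite -mulrzl; exact: cvgMl_tmp.
Qed.

(** [m] is the index n at which d n = k, if there is one. *)
Lemma cvg_series_kronecker (c : nat -> R) (d : nat -> int) k (m : option nat) :
  (forall n, (k - d n == 0) = (Some n == m)) ->
  series (fun n => c n * (k - d n == 0)%:R) @ \oo --> oapp c 0 m.
Proof.
move=> dm; apply: cvg_near_cst; case: m dm => [m|] dm /=; last first.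
  by apply: nearW => N; rewrite /series /= big1 // => n _; rewrite dm mulr0.
exists m.+1 => // N /= mN; rewrite /series /= (bigD1_seq m) ?iota_uniq //=.
  rewrite dm eqxx mulr1 big1 ?addr0 // => n nm.
  by rewrite dm (inj_eq Some_inj) (negPf nm) mulr0.
by rewrite mem_index_iota.
Qed.

Lemma poly_shift_series (c : nat -> R) (d : nat -> int) (w : int -> R) N k :
  poly_shift f (fun k => series (fun n => c n * w (k - d n)) N) k =
  series (fun n => c n * poly_shift f w (k - d n)) N.
Proof.
rewrite /poly_shift /series /=; under eq_bigr do rewrite -mulrzl mulr_sumr.
rewrite exchange_big /=; apply: eq_bigr => n _; rewrite mulr_sumr.
by apply: eq_bigr => j _; rewrite mulrCA -[in RHS]mulrzl [k + _ - _]addrAC.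
Qed.

Section Bounded.
Variables (v : int -> int) (M t : R).
Hypothesis tr : is_rate f t.
Hypothesis vM : forall n, `|(v n)%:~R : R| <= M.

Let t_gt0 : 0 < t. Proof. by apply: lt_trans tr.1. Qed.
Let tV_lt1 : t^-1 < 1. Proof. by rewrite invf_lt1 ?tr.1. Qed.
Let tV_ge0 : 0 <= t^-1. Proof. by rewrite invr_ge0 ltW. Qed.
Let M_ge0 : 0 <= M. Proof. exact: le_trans (normr_ge0 _) (vM 0). Qed.

(** The terms are O(t^(k - n)): the series is dominated by a geometric one, of
    sum O(t^k). *)
Lemma xi_star_minus k :
  let u n := (v n%:Z)%:~R * w_minus f b (k - n%:Z) in
  cvgn (series u) /\ `|limn (series u)| <= M * K * t ^ k / (1 - t^-1).
Proof.
apply: geometric_series_bound => // n; rewrite normrM -!mulrA.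
rewrite ler_pM ?vM //; apply: le_trans (w_minus_bound b f_cst _ tr) _.
by rewrite expfzDr ?gt_eqF // -exprz_inv.
Qed.

Lemma xi_star_plus k :
  let u n := (v (Negz n))%:~R * w_plus f b (k - Negz n) in
  cvgn (series u) /\ `|limn (series u)| <= M * K * t ^ (- k) / (1 - t^-1).
Proof.
apply: geometric_series_bound => // n; rewrite normrM -!mulrA.
rewrite ler_pM ?vM //; apply: le_trans (w_plus_bound b f_cst _ tr) _.
rewrite ler_wpM2l ?fundamental_cst_ge0 // exprnP exprz_inv.
by rewrite -expfzDr ?gt_eqF // ler_weXz2l ?(ltW tr.1) // NegzE; lia.
Qed.

Lemma xi_star_bound k :
  `|xi_star f b v k| <= M * K / (1 - t^-1) * growth t k.
Proof.
apply: le_trans (ler_normD _ _) _; rewrite mulrDr.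
apply: lerD; rewrite mulrAC; first exact: (xi_star_minus k).2.
exact: (xi_star_plus k).2.
Qed.

(** f(sigma) can be applied termwise, and turns both w^Delta- and w^Delta+ into
    delta_0: the first series gives back v_k for k >= 0, the second one for
    k < 0. *)
Lemma poly_shift_xi_star k : poly_shift f (xi_star f b v) k = (v k)%:~R.
Proof.
pose um N k := series (fun n => (v n%:Z)%:~R * w_minus f b (k - n%:Z)) N.
pose up N k := series (fun n => (v (Negz n))%:~R * w_plus f b (k - Negz n)) N.
have umE N : poly_shift f (um N) k =
    series (fun n => (v n%:Z)%:~R * (k - n%:Z == 0)%:R : R) N.
  rewrite poly_shift_series; apply: eq_bigr => n _; congr (_ * _).
  rewrite -(poly_shift_fundamental f_cst b_def (fun a => `|a| <= 1)).
  by apply: eq_bigr => j _; rewrite w_minusE.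
have upE N : poly_shift f (up N) k =
    series (fun n => (v (Negz n))%:~R * (k - Negz n == 0)%:R : R) N.
  rewrite poly_shift_series; apply: eq_bigr => n _; congr (_ * _).
  rewrite -(poly_shift_fundamental f_cst b_def (fun a => `|a| < 1)).
  by apply: eq_bigr => j _; rewrite w_plusE.
have lm := @cvg_series_kronecker (fun n => (v n%:Z)%:~R) Posz k
  (if k is Posz n then Some n else None).
have lp := @cvg_series_kronecker (fun n => (v (Negz n))%:~R) Negz k
  (if k is Negz n then Some n else None).
have -> : (v k)%:~R =
    oapp (fun n => (v n%:Z)%:~R) 0 (if k is Posz n then Some n else None) +
    oapp (fun n => (v (Negz n))%:~R) 0 (if k is Negz n then Some n else None)
    :> R.
  by case: (k) => n /=; rewrite ?addr0 ?add0r.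
have ml : (fun N => poly_shift f (fun k => um N k + up N k) k) @ \oo -->
    poly_shift f (xi_star f b v) k.
  apply: cvg_poly_shift => k'.
  by apply: cvgD; [exact: (xi_star_minus k').1|exact: (xi_star_plus k').1].
apply: cvg_unique ml _ => //.
have -> : (fun N => poly_shift f (fun k => um N k + up N k) k) =
    (fun N => poly_shift f (um N) k + poly_shift f (up N) k).
  apply/funext => N; rewrite /poly_shift -big_split /=.
  by apply: eq_bigr => j _; rewrite mulrzDl.
apply: cvgD; [under eq_fun do rewrite umE|under eq_fun do rewrite upE].
  by apply: lm => n; rewrite subr_eq0 [LHS]eq_sym; case: (k).
by apply: lp => n; rewrite subr_eq0 [LHS]eq_sym; case: (k).
Qed.

End Bounded.

(** w and xi^*(v) solve the same equation f(sigma) w = v and are both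
    O(t^k + t^-k), so their difference is a kernel element to which
    [kernel_bound] applies. *)
Lemma difference_xi_star_bound t M (w : int -> R) (v : int -> int) :
  is_rate f t ->
  (forall n, `|(v n)%:~R : R| <= M) ->
  (forall k, poly_shift f w k = (v k)%:~R) -> (forall n, `|w n| <= M) ->
  let w0 k := w k - xi_star f b v k in
  (forall k, poly_shift f w0 k = 0) /\
  forall k, `|w0 k| <= (M + M * K / (1 - t^-1)) * kernel_cst f b t.
Proof.
move=> tr vM fw wM w0; have t0 : 0 < t by apply: lt_trans tr.1.
have M0 : 0 <= M by exact: le_trans (normr_ge0 _) (wM 0).
have fw0 k : poly_shift f w0 k = 0.
  have -> : poly_shift f w0 k =
      poly_shift f w k - poly_shift f (xi_star f b v) k.
    by rewrite /poly_shift -sumrB; apply: eq_bigr => j _; rewrite mulrzBl.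
  by rewrite fw (poly_shift_xi_star tr vM) subrr.
split=> //; apply: (kernel_bound f_cst b_def tr _ fw0) => [|k].
  rewrite addr_ge0 // !mulr_ge0 ?fundamental_cst_ge0 // invr_ge0 subr_ge0.
  by rewrite invf_le1 // ltW // tr.1.
rewrite mulrDl; apply: le_trans (ler_normB _ _) _; apply: lerD.
  apply: le_trans (wM k) _; rewrite -[leLHS]mulr1 ler_wpM2l // /growth.
  case: k => n.
    rewrite -[leLHS]addr0 lerD ?exprz_ge0 ?(ltW t0) // -(expr0z t) ler_weXz2l //.
    exact: ltW tr.1.
  rewrite -[leLHS]add0r lerD ?exprz_ge0 ?(ltW t0) // -(expr0z t) ler_weXz2l //.
  exact: ltW tr.1.
exact: xi_star_bound.
Qed.

End SymbolicMap.

(** * Networks and measurability *)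

(** The members of a network need not be open, which makes networks stable under
    products and subspaces without any openness check.  A countable one is
    enough to recover open sets as countable unions. *)
Definition network (J : Type) (T : topologicalType) (N : J -> set T) : Prop :=
  forall y U, nbhs y U -> exists2 j, N j y & N j `<=` U.

Section Networks.

Lemma network_discrete (T : choiceType) :
  network (fun m : T => [set m] : set (discrete_topology T)).
Proof.
by move=> y U yU; exists y => // _ ->; exact: (nbhs_singleton yU).
Qed.

Lemma network_real (R : realType) :
  network (fun q : rat * rat => [set` `]ratr q.1, ratr q.2[] : set R).
Proof.
move=> y U /nbhs_ballP[e /= e0 eU].
have [p] : exists p, ratr p \in `]y - e, y[.
  by apply: rat_in_itvoo; rewrite ltrBlDr ltrDl.
have [q] : exists q, ratr q \in `]y, y + e[.
  by apply: rat_in_itvoo; rewrite ltrDl.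
rewrite !in_itv /= => /andP[yq qe] /andP[ep py].
exists (p, q); first by rewrite /= in_itv /= py yq.
move=> z /=; rewrite in_itv /= => /andP[pz zq]; apply: eU.
by rewrite /ball /= ltr_norml; apply/andP; split; lra.
Qed.

(** Finite constraints on coordinates: the sets containing a cylinder around y
    form a filter, which converges to y coordinatewise, hence is finer than the
    filter of neighbourhoods of y. *)
Lemma network_ptws (I : eqType) (J : eqType) (T : topologicalType)
    (N : J -> set T) : network N ->
  network (fun s : seq (I * J) =>
    [set w : {ptws I -> T} | forall p, p \in s -> N p.2 (w p.1)]).
Proof.
move=> netN y; pose M (s : seq (I * J)) :=
  [set w : {ptws I -> T} | forall p, p \in s -> N p.2 (w p.1)].
pose G : set_system {ptws I -> T} :=
  [set U | exists2 s, M s y & M s `<=` U].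
have FG : Filter G.
  split=> [|U V [s sy sU] [t ty tV]|U V UV [s sy sU]].
  - by exists [::].
  - exists (s ++ t); first by move=> p; rewrite mem_cat => /orP[/sy|/ty].
    move=> w wst; split; [apply: sU|apply: tV] => p ps; apply: wst;
      by rewrite mem_cat ps ?orbT.
  - by exists s => // w /sU /UV.
suff Gy : G --> (y : {ptws I -> T}) by move=> U /Gy.
apply/cvg_sup => i U; rewrite nbhsE => -[_ [[V oV <-] Vy] VU].
have [j jy jV] := netN _ _ (open_nbhs_nbhs (conj oV Vy)).
exists [:: (i, j)]; first by move=> p; rewrite inE => /eqP ->.
by move=> w /(_ (i, j)) wij; apply/VU/jV/wij; rewrite inE.
Qed.

Lemma nbhs_subtype (T : topologicalType) (A : set T) (x : A) (U : set A) :
  nbhs x U -> exists2 V, nbhs (val x) V & val @^-1` V `<=` U.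
Proof.
rewrite nbhsE => -[_ [[V oV <-] Vx] VU].
by exists V => //; exists V.
Qed.

Lemma network_subtype (J : Type) (T : topologicalType) (N : J -> set T)
    (A : set T) : network N ->
  network (fun j => val @^-1` (N j) : set A).
Proof.
move=> netN x U /nbhs_subtype[V /netN[j jx jV] VU].
by exists j => // z /= /jV /VU.
Qed.

Lemma network_prod (J1 J2 : Type) (T1 T2 : topologicalType)
    (N1 : J1 -> set T1) (N2 : J2 -> set T2) : network N1 -> network N2 ->
  network (fun j : J1 * J2 => N1 j.1 `*` N2 j.2).
Proof.
move=> net1 net2 [x y] U [[V W] /= [/net1[i ix iV] /net2[j jy jW]] VWU].
exists (i, j) => //= -[z t] [/= iz jt].
by apply: VWU; split; [apply: iV|apply: jW].
Qed.

Lemma measurable_preimage_open d (X : measurableType d) (J : countType)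
    (T : topologicalType) (N : J -> set T) (s : X -> T) : network N ->
  (forall j, measurable (s @^-1` N j)) ->
  forall U, open U -> measurable (s @^-1` U).
Proof.
move=> netN mN U oU.
have -> : s @^-1` U = \bigcup_(j in [set j | N j `<=` U]) (s @^-1` N j).
  apply/seteqP; split=> [x /= Ux|x [j /= jU jx]]; last exact: jU.
  by have [j jx jU] := netN _ _ (open_nbhs_nbhs (conj oU Ux)); exists j.
rewrite bigcup_mkcond; apply: countable_bigcupT_measurable => // j.
by case: ifP.
Qed.

Lemma measurable_preimage_cylinder d (X : measurableType d) (I J : eqType)
    (T : Type) (N : J -> set T) (s : X -> I -> T) :
  (forall i j, measurable [set x | N j (s x i)]) ->
  forall l : seq (I * J),
    measurable [set x | forall p, p \in l -> N p.2 (s x p.1)].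
Proof.
move=> mN; elim=> [|p l IH].
  by rewrite (_ : [set x | _] = setT) //; apply/seteqP; split.
rewrite (_ : [set x | _] = [set x | N p.2 (s x p.1)] `&`
  [set x | forall p, p \in l -> N p.2 (s x p.1)]); first exact: measurableI.
apply/seteqP; split=> [x xP|x [xp xl] q] /=.
  by split=> [|q ql]; apply: xP; rewrite inE ?eqxx ?ql ?orbT.
by rewrite inE => /orP[/eqP ->|/xl].
Qed.

(** Compactness in the subspace topology, through the clusters of the image
    filter in the ambient space. *)
Lemma compact_subtype (T : topologicalType) (A K : set T) :
  K `<=` A -> compact K -> compact (val @^-1` K : set A).
Proof.
move=> KA cK F FF FK.
have [p [Kp clp]] := cK (val @ F) _ FK.
have pA : p \in A by apply/mem_set/KA.
exists (exist (fun x => x \in A) p pA); split=> // B U FB.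
move=> /nbhs_subtype[V pV VU].
have FV : (val @ F) (val @` B).
  exact: (@filterS _ F _ _ _ (@preimage_image _ _ val B) FB).
have [_ [[x Bx <-] Vx]] := clp _ V FV pV.
by exists x; split=> //; apply: VU.
Qed.

End Networks.

(** * Representatives of points of the circle *)

Section Circle.
Variable R : realType.

Definition circle_lift (x : circle R) : R :=
  repr x - (Num.floor (repr x : R))%:~R.

Lemma pi_circle_eq (r s : R) :
  (\pi_(circle R) r)%qT = (\pi_(circle R) s)%qT <-> r - s \is a Num.int.
Proof.
have e : (r - s \in integers R) <-> (r = s %[mod {ideal_quot integers R}])%qT.
  by rewrite Quotient.idealrBE; split=> /eqP.
exact: (iff_sym e).
Qed.

Lemma circle_liftK x : (\pi_(circle R) (circle_lift x))%qT = x.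
Proof.
rewrite -[RHS]reprK; apply/pi_circle_eq.
by rewrite /circle_lift addrAC subrr add0r rpredN intr_int.
Qed.

Lemma circle_lift_pi (r : R) :
  circle_lift (\pi_(circle R) r)%qT = r - (Num.floor r)%:~R.
Proof.
have : repr (\pi_(circle R) r)%qT - r \is a Num.int.
  by apply/pi_circle_eq; rewrite reprK.
rewrite /circle_lift; set s := repr _ => sr.
rewrite -[s in LHS](subrK r) floorDzr // rmorphD /= floorK //.
by rewrite opprD addrACA subrr add0r.
Qed.

Lemma circle_lift_itv x : 0 <= circle_lift x < 1.
Proof.
rewrite /circle_lift subr_ge0 floor_le /= ltrBlDl.
by have := floorD1_gt (repr x : R); rewrite rmorphD.
Qed.

Lemma circle_lift_norm x : `|circle_lift x| <= 1.
Proof. by have /andP[h0 h1] := circle_lift_itv x; rewrite ger0_norm // ltW. Qed.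

(** The fractional part is lower semicontinuous: its only jumps are downwards,
    at the integers.  This gives the measurability of the representative. *)
Lemma open_circle_lift_gt (a : R) : open [set x : circle R | a < circle_lift x].
Proof.
change (open ((\pi_(circle R))%qT @^-1`
  [set x : circle R | a < circle_lift x] : set R)).
have -> : (\pi_(circle R))%qT @^-1` [set x : circle R | a < circle_lift x] =
   [set r : R | a < r - (Num.floor r)%:~R].
  by apply/seteqP; split=> r /=; rewrite circle_lift_pi.
have [a0|a0] := ltP a 0.
  rewrite (_ : [set r : R | _] = setT); first exact: openT.
  by apply/seteqP; split=> r //= _; rewrite (lt_le_trans a0) // subr_ge0 floor_le.
have -> : [set r : R | a < r - (Num.floor r)%:~R] =
    \bigcup_(m : int) [set` `]m%:~R + a, (m + 1)%:~R[].
  apply/seteqP; split=> [r /= ar|r [m _] /=].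
    by exists (Num.floor r) => //=; rewrite in_itv /= -ltrBrDl ar floorD1_gt.
  rewrite in_itv /= => /andP[mr rm]; rewrite (_ : Num.floor r = m) ?ltrBrDl //.
  by apply: floor_def; rewrite rm andbT ltW // (le_lt_trans _ mr) // lerDl.
by apply: bigcup_open => m _; exact: interval_open.
Qed.

Lemma pi_circleD :
  {morph (fun r : R => (\pi_(circle R) r)%qT) : r s / r + s >-> r + s}.
Proof. exact: Quotient.pi_add. Qed.

Lemma pi_circle0 : (\pi_(circle R) (0 : R))%qT = 0.
Proof.
by apply: (addrI (\pi_(circle R) (0 : R))%qT); rewrite -pi_circleD !addr0.
Qed.

Lemma pi_poly_shift (f : {poly int}) (w : int -> R) k :
  (\pi_(circle R) (poly_shift f w k))%qT = poly_shift f (rho w) k.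
Proof.
have piN : {morph (fun r : R => (\pi_(circle R) r)%qT) : r / - r >-> - r}.
  exact: Quotient.pi_opp.
have piM (r : R) n : (\pi_(circle R) (r *+ n))%qT = (\pi_(circle R) r)%qT *+ n.
  elim: n => [|n IH]; first exact: pi_circle0.
  by rewrite !mulrS -IH -pi_circleD.
rewrite /poly_shift (big_morph _ pi_circleD pi_circle0); apply: eq_bigr => j _.
by case: (f`_j) => n; rewrite /intmul ?piN piM.
Qed.

End Circle.

(** * The equivariant section of the factor map *)

Section EquivariantSection.
Variables (R : realType) (f : {poly int}) (b : R[i] -> R[i]).
Hypothesis f_cst : f`_0 != 0.
Hypothesis b_def : partial_fraction f b.

Definition lift (x : X R f) (n : int) : R := circle_lift (val x n).

Lemma rho_lift x : rho (lift x) = val x.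
Proof. by apply/funext => n; exact: circle_liftK. Qed.

Definition digits (x : X R f) (n : int) : int :=
  Num.floor (poly_shift f (lift x) n).

Lemma digitsE x n : (digits x n)%:~R = poly_shift f (lift x) n.
Proof.
apply: floorK; rewrite -[X in X \is a _]subr0; apply/pi_circle_eq.
by rewrite pi_poly_shift rho_lift pi_circle0; have /set_mem := valP x; apply.
Qed.

(** The summand 1 makes the same constant bound [lift] too. *)
Definition height : int := 1 + \sum_(j < size f) `|f`_j|.

Lemma height_ge1 : 1 <= height.
Proof. by rewrite lerDl sumr_ge0. Qed.

Lemma digits_bound x n : `|digits x n| <= height.
Proof.
rewrite -(ler_int R) intr_norm digitsE; apply: le_trans (ler_norm_sum _ _ _) _.
rewrite rmorphD rmorph_sum /= -[leLHS]add0r lerD // ?ler01 //.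
apply: ler_sum => j _; rewrite normrMz -[leLHS]mulrzl.
by rewrite ler_piMr ?ler0z // circle_lift_norm.
Qed.

Definition offset (x : X R f) (n : int) : R :=
  lift x n - xi_star f b (digits x) n.

(** The bounds on [lift] and [digits] are uniform in x, hence so is D. *)
Lemma offset_bound : exists D : R, forall x,
  (forall k, poly_shift f (offset x) k = 0) /\ forall k, `|offset x k| <= D.
Proof.
have [t tr] := is_rate_exists R f_cst; eexists => x.
apply: (difference_xi_star_bound f_cst b_def (M := height%:~R) tr) => n.
- by rewrite -intr_norm ler_int digits_bound.
- by rewrite digitsE.
- apply: le_trans (circle_lift_norm _) _.
  by rewrite -[1]/(1%:~R) ler_int height_ge1.
Qed.

Lemma digits_linf x :
  (digits x : {ptws int -> discrete_topology int}) \in linf_int_set.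
Proof. by apply/mem_set; exists height; exact: digits_bound. Qed.

Lemma offset_W0 x : (offset x : {ptws int -> R}) \in @W0set R f.
Proof.
have [D DP] := offset_bound; have [f0 bd] := DP x.
by apply/mem_set; split=> //; exists D.
Qed.

Definition lifting (x : X R f) : Ytilde R f :=
  (exist (fun v => v \in linf_int_set) _ (digits_linf x),
   exist (fun w => w \in @W0set R f) _ (offset_W0 x)).

Lemma digits_alpha x : digits (alpha x) = sigma_bar 1 (digits x).
Proof.
by apply/funext => n; rewrite [RHS]/sigma_bar /digits -poly_shift_sigma.
Qed.

(** The cocycle d(1, v) is the defect of equivariance of xi^*, so the terms
    xi^*(digits x) cancel and only the equivariance of [lift] is left. *)
Lemma lifting_alpha x : sigma_tilde b (lifting x) = lifting (alpha x).
Proof.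
rewrite /sigma_tilde; congr pair; apply: val_inj => /=.
  by rewrite digits_alpha.
have e : (fun k => sigma_bar 1 (offset x) k + cocycle f b 1 (digits x) k) =
    offset (alpha x).
  apply/funext => k; rewrite /offset digits_alpha /cocycle /sigma_bar.
  by rewrite addrA subrK.
by rewrite e insubdK //; exact: offset_W0.
Qed.

Lemma liftingK : cancel lifting (xi_tilde b).
Proof.
move=> x; apply: val_inj; rewrite /xi_tilde /=.
have e : rho (fun k => xi_star f b (digits x) k + offset x k) = val x.
  by rewrite -rho_lift; congr rho; apply/funext => k; rewrite /offset addrC subrK.
by rewrite e insubdK //; exact: valP.
Qed.

End EquivariantSection.

(** * Measurability and compactness of the section *)

Section Measurability.
Variables (R : realType) (f : {poly int}) (b : R[i] -> R[i]).
Hypothesis f_cst : f`_0 != 0.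
Hypothesis b_def : partial_fraction f b.

Local Notation BX := (borel (X R f)).

Lemma measurable_lift n : measurable_fun setT (fun x : BX => lift x n).
Proof.
apply: (measurability (RGenOInfty.G (R := R))).
  exact: RGenOInfty.measurableE.
move=> _ [_ [a ->] <-]; rewrite setTI; apply: sub_sigma_algebra.
exists (proj n @^-1` [set z : circle R | a < circle_lift z]).
  apply: open_comp; last exact: open_circle_lift_gt.
  by move=> w _; exact: proj_continuous.
by apply/seteqP; split=> x /=; rewrite in_itv /= andbT.
Qed.

Lemma measurable_digits n :
  measurable_fun setT (fun x : BX => (digits x n)%:~R : R).
Proof.
under eq_fun do rewrite digitsE; apply: measurable_sum => j.
under eq_fun do rewrite -mulrzl.
by apply: measurable_funM => //; exact: measurable_lift.
Qed.

Lemma measurable_digits_eq n m :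
  measurable [set x : BX | digits x n = m].
Proof.
have := measurable_digits n measurableT (measurable_set1 (m%:~R : R)).
rewrite setTI; congr measurable; apply/seteqP; split=> x /=; last by move=> ->.
by move/eqP; rewrite eqr_int => /eqP.
Qed.

Lemma measurable_offset n :
  measurable_fun setT (fun x : BX => offset b x n).
Proof.
apply: measurable_funB; first exact: measurable_lift.
have [t tr] := is_rate_exists R f_cst.
have vM (x : BX) k : `|(digits x k)%:~R : R| <= (height f)%:~R.
  by rewrite -intr_norm ler_int digits_bound.
apply: measurable_funD.
  apply: measurable_fun_cvg; last first.
    by move=> x _; exact: (xi_star_minus b f_cst tr (vM x) n).1.
  move=> N; apply: measurable_sum => k.
  by apply: measurable_funM => //; exact: measurable_digits.
apply: measurable_fun_cvg; last first.
  by move=> x _; exact: (xi_star_plus b f_cst tr (vM x) n).1.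
move=> N; apply: measurable_sum => k.
by apply: measurable_funM => //; exact: measurable_digits.
Qed.

Lemma measurable_lifting :
  measurable_fun setT (lifting f_cst b_def : BX -> borel (Ytilde R f)).
Proof.
apply: (@measurability _ _ BX (borel (Ytilde R f)) setT _
  (@open (Ytilde R f))) => //.
move=> _ [U oU <-]; rewrite setTI.
have net := network_prod
  (network_subtype (A := linf_int_set)
    (network_ptws (I := int) (@network_discrete int)))
  (network_subtype (A := @W0set R f)
    (network_ptws (I := int) (@network_real R))).
have mdigits := measurable_preimage_cylinder (X := BX)
  (N := fun m : int => [set m]) (s := @digits R f) (@measurable_digits_eq).
have moffset := measurable_preimage_cylinder (X := BX) (s := offset b)
  (N := fun q : rat * rat => [set` `]ratr q.1, ratr q.2[]).
apply: (measurable_preimage_open (X := BX) net _ oU) => -[l1 l2].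
apply: (measurableI _ _ (mdigits l1)); apply: moffset => n q.
by rewrite -[X in measurable X]setTI; apply: measurable_offset.
Qed.

Lemma compact_integer_box (N : int) :
  compact [set v : linf_int | forall n, `|val v n| <= N].
Proof.
pose K := [set v : {ptws int -> discrete_topology int} |
  forall n, [set m : int | `|m| <= N] (v n)].
apply: (@compact_subtype _ linf_int_set K).
  by move=> v vN; exists N; exact: vN.
have finN : finite_set [set m : int | `|m| <= N].
  pose r := [seq n%:Z - N | n <- iota 0 (absz (N + N)).+1].
  apply: (@sub_finite_set _ _ [set` r]); last exact: finite_seq.
  move=> m /= mN; apply/mapP; exists (absz (m + N)); last by lia.
  by rewrite mem_iota; lia.
apply: (@tychonoff int (fun=> discrete_topology int)
  (fun=> [set m : int | `|m| <= N])) => _.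
exact: finite_compact.
Qed.

Lemma compact_central_ball (D : R) :
  compact [set w : W0 R f | forall n, `|val w n| <= D].
Proof.
pose B := [set w : {ptws int -> R} | forall n, [set` `[- D, D]] (w n)].
pose Z := [set w : {ptws int -> R} | forall k, poly_shift f w k = 0].
have cB : compact B.
  apply: (@tychonoff int (fun=> R) (fun=> [set` `[- D, D]])) => _.
  exact: segment_compact.
have cZ : closed Z.
  have -> : Z = \bigcap_k
      ((fun w : {ptws int -> R} => poly_shift f w k) @^-1` [set 0]).
    by apply/seteqP; split=> [w wP k _|w wP k]; [exact: wP|exact: (wP k I)].
  apply: closed_bigI => k _; apply: preimage_closed; last exact: closed_eq.
  move=> w _; apply: (@cvg_poly_shift R f _ (nbhs w) id) => n.
  exact: (@proj_continuous int (fun=> R) n w).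
have -> : [set w : W0 R f | forall n, `|val w n| <= D] = val @^-1` (B `&` Z).
  apply/seteqP; split=> [w wD|w [wB _] n] /=.
    split=> [n|k]; first by rewrite /= in_itv /= -ler_norml; exact: wD.
    by have /set_mem[] := valP w.
  by move: (wB n); rewrite /= in_itv /= -ler_norml; exact.
apply: compact_subtype.
  move=> w [wB wZ]; split=> //; exists D => n.
  by move: (wB n); rewrite /= in_itv /= -ler_norml; exact.
exact: compact_closedI.
Qed.

Lemma lifting_compact : exists2 K : set (Ytilde R f), compact K &
  forall x, K (lifting f_cst b_def x).
Proof.
have [D DP] := offset_bound f_cst b_def.
exists ([set v : linf_int | forall n, `|val v n| <= height f] `*`
        [set w : W0 R f | forall n, `|val w n| <= D]).
  by apply: compact_setX; [exact: compact_integer_box|exact: compact_central_ball].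
by move=> x; split=> n /=; [exact: digits_bound|exact: (DP x).2].
Qed.

(** Equality in X is detected by countably many real coordinates, so the
    diagonal is measurable for the product of the Borel sigma-algebras. *)
Lemma measurable_off_diagonal : measurable
  [set p : BX * BX | exists n, lift p.1 n != lift p.2 n].
Proof.
have -> : [set p : BX * BX | exists n, lift p.1 n != lift p.2 n] =
  \bigcup_n ((fun p => lift p.1 n - lift p.2 n) @^-1` [set~ 0]).
  apply/seteqP; split=> [p [n pn]|p [n _ pn]]; exists n => //.
    by move=> /= /eqP; rewrite subr_eq0; exact/negP.
  by rewrite -subr_eq0; apply/eqP.
apply: countable_bigcupT_measurable => // n.
have mdiff : measurable_fun setT (fun p : BX * BX => lift p.1 n - lift p.2 n).
  apply: measurable_funB.
    apply: (measurableT_comp (measurable_lift n)); exact: measurable_fst.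
  apply: (measurableT_comp (measurable_lift n)); exact: measurable_snd.
have := mdiff measurableT _ (measurableC (measurable_set1 0)).
by rewrite setTI.
Qed.

End Measurability.

(** * Invariant measures *)

Lemma image_probability d d' (T : measurableType d) (T' : measurableType d')
    (R : realType) (P : probability T R) (g : T -> T') :
  measurable_fun setT g ->
  exists Q : probability T' R, forall A, Q A = P (g @^-1` A).
Proof.
move=> mg; pose mixin := isMeasurableFun.Build _ _ T T' g mg.
pose G : {mfun T >-> T'} := HB.pack g mixin.
by exists (distribution P G).
Qed.

Theorem theorem1p1 (R : realType) (f : {poly int}) (b : R[i] -> R[i])
  (f_deg : (1 < size f)%N) (f_lead : 0 < lead_coef f) (f_cst : f`_0 != 0)
  (f_irr : laurent_irreducible (tofrac f))
  (b_def : partial_fraction f b)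
  (f_nonhyp : nonhyperbolic R f) (f_noncyc : ~ cyclotomic R f)
  (mu : probability (borel (X R f)) R)
  (mu_inv : invariant_measure mu (@alpha R f)) :
  exists nu : probability (borel (Ytilde R f)) R,
    [/\ invariant_measure nu (sigma_tilde b),
        centrally_equivalent mu
          (pushforward nu (xi_tilde b : borel (Ytilde R f) -> borel (X R f))) &
        compactly_supported nu].
Proof.
pose s := lifting f_cst b_def.
have ms := measurable_lifting f_cst b_def.
have mdiag : measurable_fun setT (fun x : borel (X R f) => (x, x)).
  by apply: measurable_fun_pair; exact: measurable_id.
have [nu nuE] := image_probability mu ms.
have [varrho varrhoE] := image_probability mu mdiag.
exists nu; split.
- move=> A mA; rewrite /pushforward !nuE.
  have := mu_inv (s @^-1` A); rewrite /pushforward => <-.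
    by congr (mu _); apply/seteqP; split=> x; rewrite /= lifting_alpha.
  by rewrite -[X in measurable X]setTI; exact: ms.
- exists varrho; split.
  + move=> A mA; rewrite /pushforward !varrhoE.
    apply: (mu_inv ((fun x => (x, x)) @^-1` A)).
    by rewrite -[X in measurable X]setTI; exact: mdiag.
  + by move=> A mA; rewrite /pushforward varrhoE.
  + move=> A mA; rewrite /pushforward varrhoE nuE; congr (mu _).
    by apply/seteqP; split=> x; rewrite /= liftingK.
  + exists [set p | exists n, lift p.1 n != lift p.2 n]; split.
    * exact: measurable_off_diagonal.
    * rewrite varrhoE; apply/eqP; rewrite -(measure0 mu); apply/eqP.
      by congr (mu _); apply/seteqP; split=> x //= -[n]; rewrite eqxx.
    * move=> p /= np; apply: contrapT => /forallNP same; apply: np.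
      exists (fun=> 0); first exact/set_mem/W0set0.
      apply/funext => n; have /negP/negPn/eqP e := same n.
      by rewrite -!rho_lift /rho e subrr; exact: pi_circle0.
- have [K cK sK] := lifting_compact f_cst b_def.
  exists K => //; rewrite nuE -(measure0 mu); congr (mu _).
  by apply/seteqP; split=> x //=; apply; exact: sK.
Qed.
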